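(* Let $r \geq 3$ be an integer. For infinitely many values $\gamma \geq 0$, there exists an $r$-connected graph $G$ of Euler genus $\gamma$ satisfying $\kappa_\rho(G) < 4\gamma^{-1/r}$.
   Context: For a tree $T$, $\Lambda(T)$ denotes its set of leaves. For a connected graph $G$, $\tau_G$ is the set of spanning trees of $G$. The robust connectivity of $G$ is $\kappa_\rho(G) = \min_{\emptyset \neq R \subseteq V(G)} \max_{T \in \tau_G} \frac{|R \cap \Lambda(T)|}{|R|}$. The Euler genus of a graph is the minimum Euler genus of a surface in which it embeds. Graphs are simple. *)

(* Defs.v *)
From HB Require Import structures.
From mathcomp Require Import all_boot all_order all_algebra.
From mathcomp Require Import reals.

Set Implicit Arguments.
Unset Strict Implicit.
Unset Printing Implicit Defensive.

Import Order.TTheory GRing.Theory Num.Theory.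

Record sgraph := SGraph {
  vertex :> finType;
  adj : rel vertex;
  adj_sym : symmetric adj;
  adj_irr : irreflexive adj }.

Definition edges (G : sgraph) : {set {set G}} :=
  [set E : {set G} | [exists x : G, exists y : G, adj x y && (E == [set x; y])]].

Definition connected_rel (V : finType) (e : rel V) : bool :=
  [forall x, forall y, connect e x y].

Definition r_connected (r : nat) (G : sgraph) : Prop :=
  r < #|G| /\
  forall S : {set G}, #|S| < r ->
    {in ~: S &, forall x y,
      connect [rel u v | [&& u \notin S, v \notin S & adj u v]] x y}.

Section SpanningTrees.

Variable G : sgraph.

(* A spanning subgraph of G is given by its edge set T. *)
Definition sub_adj (T : {set {set G}}) : rel G := [rel x y | [set x; y] \in T].

(* The bound on the length n loses nothing: a cycle has distinct vertices. *)
Definition acyclic_rel (e : rel G) : bool :=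
  [forall n : 'I_(#|G|.+1), forall c : n.-tuple G,
     ~~ [&& 2 < n, uniq c & cycle e c]].

Definition spanning_tree (T : {set {set G}}) : bool :=
  [&& T \subset edges G, connected_rel (sub_adj T) & acyclic_rel (sub_adj T)].

Definition leaves (T : {set {set G}}) : {set G} :=
  [set x | #|[set y | sub_adj T x y]| == 1].

End SpanningTrees.

(* The ratios lie in [0, 1], so the default values 0 of the maximum and 1 of  *)
(* the minimum do not affect the result when G is connected and nonempty.     *)
Definition robust_connectivity (R : realType) (G : sgraph) : R :=
  (\big[Num.min/1]_(X : {set G} | X != set0)
    \big[Num.max/0]_(T : {set {set G}} | spanning_tree T)
      (#|X :&: leaves T|%:R / #|X|%:R))%R.

(* A closed connected surface (orientable or not) with a finite cell          *)
(* decomposition, presented by its flags (the triangles of its barycentric    *)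
(* subdivision): t_i sends a flag to the one differing from it exactly in its *)
(* i-dimensional cell. Fixed-point freeness excludes boundary. Cells may be   *)
(* degenerate (loops, multiple edges, faces of any length).                   *)
Record surface := Surface {
  flag :> finType;
  t0 : flag -> flag;
  t1 : flag -> flag;
  t2 : flag -> flag;
  t0K : involutive t0;
  t1K : involutive t1;
  t2K : involutive t2;
  t0_free : forall x, t0 x != x;
  t1_free : forall x, t1 x != x;
  t2_free : forall x, t2 x != x;
  t02C : forall x, t0 (t2 x) = t2 (t0 x);
  t02_free : forall x, t0 (t2 x) != x;
  flag_gt0 : 0 < #|flag|;
  flag_connected :
    connected_rel [rel x y : flag | [|| y == t0 x, y == t1 x | y == t2 x]] }.

Section Cells.

Variable M : surface.

(* Two flags share a cell of dimension i iff they are linked by the t_j with  *)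
(* j != i; so cells of dimension i are the components of these relations.     *)
Definition vertex_step : rel M := [rel x y | (y == t1 x) || (y == t2 x)].
Definition edge_step : rel M := [rel x y | (y == t0 x) || (y == t2 x)].
Definition face_step : rel M := [rel x y | (y == t0 x) || (y == t1 x)].

Definition euler_char : int :=
  ((n_comp vertex_step predT)%:Z - (n_comp edge_step predT)%:Z
     + (n_comp face_step predT)%:Z)%R.

Definition surface_euler_genus : int := (2 - euler_char)%R.

End Cells.

(* G embeds in the surface when some cell decomposition of the surface has G  *)
(* as a subgraph of its 1-skeleton; the embedding of G itself need not be     *)
(* cellular. The vertex x of G is sent to the vertex of the decomposition     *)
(* containing the flag f x. As G is simple, distinct edges of G get distinct  *)
(* edges of the 1-skeleton.                                                   *)
Definition embeds (G : sgraph) (M : surface) : Prop :=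
  exists f : G -> M,
    (forall x y, connect (@vertex_step M) (f x) (f y) -> x = y) /\
    (forall x y, adj x y -> exists d : M,
       connect (@vertex_step M) (f x) d /\
       connect (@vertex_step M) (f y) (t0 d)).

Definition has_euler_genus (G : sgraph) (g : nat) : Prop :=
  (exists M : surface, embeds G M /\ surface_euler_genus M = Posz g) /\
  (forall M : surface, embeds G M -> (Posz g <= surface_euler_genus M)%R).

(* Main.v *)
Require Import Defs.
From mathcomp Require Import boolp classical_sets cardinality reals exp.
From mathcomp Require Import all_boot all_order all_algebra zify ring.

(**
   The graph is the incidence graph G of the points 1, ..., k and all
   r-subsets of the points.  If all points of an r-subset A were leaves of a
   spanning tree, the tree component of A would be a star contained in A; so a
   spanning tree has at most r - 1 points among its leaves, and the robust
   connectivity is at most (r - 1) / k.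

   A rotation system embeds G in a surface of Euler genus at most
   |E(G)| = r C(k, r) <= k^r / (r - 1)!, and (r - 1)^r < 4^r (r - 1)!, which
   gives the required inequality.

   The genus is unbounded in k because a bipartite graph embedded in a surface
   satisfies |E| <= 2 genus + 2 |V|.  This is proved by linear algebra over
   F_2, without making the embedding cellular: the Euler genus of the surface
   M is dim Z(M) - dim B(M) for its cycle and boundary spaces, hence at least
   dim Z(G) - dim (Z(G) :&: B(M)).  The first term is at least |E| - |V|; the
   second is at most the number of regions of M cut along G, and each region
   has at least four sides, its boundary being a cycle of G modulo 2.
*)

Set Implicit Arguments.
Unset Strict Implicit.
Unset Printing Implicit Defensive.

Import Order.TTheory GRing.Theory Num.Theory.

(** * Components of a symmetric relation *)

Section Components.

Variables (T : finType) (e : rel T).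

(** Root representatives make the components a finite type that can index matrices and whose
    cardinality is [n_comp]. *)
Definition component : finType := {x : T | roots e x}.

Lemma card_component : #|component| = n_comp e predT.
Proof. by rewrite card_sig; apply: eq_card => x; rewrite !inE andbT. Qed.

Hypothesis sym_e : symmetric e.
Let csym := sym_connect_sym sym_e.

Definition comp_of (x : T) : component := exist _ (fingraph.root e x) (roots_root csym x).

Lemma eq_comp_of x y : (comp_of x == comp_of y) = connect e x y.
Proof. by rewrite -val_eqE /= root_connect. Qed.

Lemma comp_ofP x y : reflect (comp_of x = comp_of y) (connect e x y).
Proof. by rewrite -eq_comp_of; apply: eqP. Qed.

Lemma comp_of_step x y : e x y -> comp_of x = comp_of y.
Proof. by move=> exy; apply/comp_ofP/connect1. Qed.

Lemma comp_of_val (c : component) : comp_of (val c) = c.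
Proof. by apply/val_inj/eqP; case: c. Qed.

End Components.

Lemma connect_invariant (T : finType) (U : Type) (e : rel T) (g : T -> U) :
  (forall x y, e x y -> g x = g y) -> forall x y, connect e x y -> g x = g y.
Proof.
move=> ge x y /connectP[p]; elim: p x => [|z p IH] x /= => [_ -> //|].
by move=> /andP[/ge-> /IH].
Qed.

Local Open Scope ring_scope.

(** * Sums modulo 2 *)

Lemma addrr_F2 (x : 'F_2) : x + x = 0.
Proof. exact: (addrr_pchar2 (pchar_Fp (isT : prime 2))). Qed.

Lemma addr_eq0_F2 (x y : 'F_2) : x + y = 0 -> x = y.
Proof. by move=> xy; rewrite -[x]addr0 -(addrr_F2 y) addrA xy add0r. Qed.

Lemma sum_free_involution (T : finType) (s : T -> T) (g : T -> 'F_2) :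
  involutive s -> (forall x, s x != x) -> (forall x, g (s x) = g x) ->
  \sum_x g x = 0.
Proof.
(* [P] picks from each orbit of [s] the element of smaller rank; the two halves of the sum agree and
   cancel. *)
move=> sK s_free gs; pose P x := (enum_rank x < enum_rank (s x))%N.
rewrite (bigID P) /= [X in _ + X](reindex_inj (inv_inj sK)) /=.
rewrite [X in _ + X](_ : _ = \sum_(i | P i) g i) ?addrr_F2 //.
apply: eq_big => [x|x _]; last exact: gs.
rewrite /P sK -leqNgt leq_eqVlt; apply/orb_idl => /eqP/val_inj/enum_rank_inj/eqP.
by rewrite eq_sym (negPf (s_free x)).
Qed.

Lemma sum_mul_delta (T : finType) (u : T -> 'F_2) i :
  \sum_j u j * (i == j)%:R = u i.
Proof.
rewrite (bigD1 i) //= eqxx mulr1 big1 ?addr0 // => j.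
by rewrite eq_sym => /negPf->; rewrite mulr0.
Qed.

(** * Matrices indexed by finite types *)

Section FunMatrix.

Variable F : fieldType.
Implicit Types T U W : finType.

Definition fun_mx T U (g : T -> U -> F) : 'M[F]_(#|T|, #|U|) :=
  \matrix_(i, j) g (enum_val i) (enum_val j).

Definition fun_rV U (g : U -> F) : 'rV[F]_#|U| := \row_j g (enum_val j).

Lemma fun_rVE U (v : 'rV[F]_#|U|) : v = fun_rV (fun j => v 0 (enum_rank j)).
Proof. by apply/rowP => j; rewrite mxE enum_valK. Qed.

Lemma fun_rV_inj U (g h : U -> F) : fun_rV g = fun_rV h -> g =1 h.
Proof. by move=> /rowP gh j; have := gh (enum_rank j); rewrite !mxE enum_rankK. Qed.

Lemma eq_fun_rV U (g h : U -> F) : g =1 h -> fun_rV g = fun_rV h.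
Proof. by move=> gh; apply/rowP => j; rewrite !mxE. Qed.

Lemma row_fun_mx T U (g : T -> U -> F) i : row i (fun_mx g) = fun_rV (g (enum_val i)).
Proof. by apply/rowP => j; rewrite !mxE. Qed.

Lemma mul_fun_rV T U (u : T -> F) (g : T -> U -> F) :
  fun_rV u *m fun_mx g = fun_rV (fun j => \sum_i u i * g i j).
Proof.
apply/rowP => j; rewrite !mxE (big_enum_val (A := T)) /=.
by apply: eq_bigr => i _; rewrite !mxE.
Qed.

Lemma mul_fun_mx T U W (g : T -> U -> F) (h : U -> W -> F) :
  fun_mx g *m fun_mx h = fun_mx (fun i j => \sum_k g i k * h k j).
Proof. by apply/row_matrixP => i; rewrite row_mul !row_fun_mx mul_fun_rV. Qed.

Lemma tr_fun_mx T U (g : T -> U -> F) : (fun_mx g)^T = fun_mx (fun j i => g i j).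
Proof. by apply/matrixP => i j; rewrite !mxE. Qed.

(** The left kernel lies in the line of constant vectors. Connectedness of a surface will supply the
    hypothesis. *)
Lemma rank_fun_mx_ker_const T U (g : T -> U -> F) :
  (forall u : T -> F, (forall j, \sum_i u i * g i j = 0) -> forall i i', u i = u i') ->
  (#|T| <= (\rank (fun_mx g)).+1)%N.
Proof.
move=> kerg; have: (\rank (kermx (fun_mx g)) <= 1)%N.
  apply: leq_trans (rank_leq_row (fun_rV (fun _ : T => 1))); apply: mxrankS.
  apply/rV_subP => v /sub_kermxP; rewrite (fun_rVE v) mul_fun_rV => v0.
  have {}v0 j : \sum_i v 0 (enum_rank i) * g i j = 0.
    by have /fun_rV_inj -> : fun_rV (fun j => \sum_i v 0 (enum_rank i) * g i j) = fun_rV (fun=> 0)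
      by rewrite v0; apply/rowP => j'; rewrite !mxE.
  have vc := kerg _ v0; case: (pickP (fun _ : T => true)) => [i0 _ | T0].
    rewrite (_ : fun_rV _ = v 0 (enum_rank i0) *: fun_rV (fun=> 1)) ?scalemx_sub //.
    by apply/rowP => j; rewrite !mxE mulr1 (vc _ i0).
  rewrite (_ : fun_rV _ = 0) ?sub0mx //.
  by apply/rowP => j; have := T0 (enum_val j).
rewrite mxrank_ker; lia.
Qed.

End FunMatrix.

Prenex Implicits vertex_step edge_step face_step t0 t1 t2.

(** * Chain complexes of surfaces over F_2 *)

Section SurfaceChains.

Variable M : surface.

Lemma vertex_step_sym : symmetric (@vertex_step M).
Proof.
by move=> x y; rewrite /vertex_step /= !(eq_sym y) (inv_eq (@t1K M)) (inv_eq (@t2K M)).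
Qed.

Lemma edge_step_sym : symmetric (@edge_step M).
Proof.
by move=> x y; rewrite /edge_step /= !(eq_sym y) (inv_eq (@t0K M)) (inv_eq (@t2K M)).
Qed.

Lemma face_step_sym : symmetric (@face_step M).
Proof.
by move=> x y; rewrite /face_step /= !(eq_sym y) (inv_eq (@t0K M)) (inv_eq (@t1K M)).
Qed.

Definition vx := comp_of vertex_step_sym.
Definition ed := comp_of edge_step_sym.
Definition fc := comp_of face_step_sym.

Lemma vx_t1 x : vx (t1 x) = vx x.
Proof. by apply/esym/comp_of_step; rewrite /vertex_step /= eqxx. Qed.
Lemma vx_t2 x : vx (t2 x) = vx x.
Proof. by apply/esym/comp_of_step; rewrite /vertex_step /= eqxx orbT. Qed.
Lemma ed_t0 x : ed (t0 x) = ed x.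
Proof. by apply/esym/comp_of_step; rewrite /edge_step /= eqxx. Qed.
Lemma ed_t2 x : ed (t2 x) = ed x.
Proof. by apply/esym/comp_of_step; rewrite /edge_step /= eqxx orbT. Qed.
Lemma fc_t0 x : fc (t0 x) = fc x.
Proof. by apply/esym/comp_of_step; rewrite /face_step /= eqxx. Qed.
Lemma fc_t1 x : fc (t1 x) = fc x.
Proof. by apply/esym/comp_of_step; rewrite /face_step /= eqxx orbT. Qed.

(** The orbit of [x] under the Klein four-group generated by [t0] and [t2], which acts freely. *)
Definition edge_flags (x : M) : seq M := [:: x; t0 x; t2 x; t0 (t2 x)].

Lemma uniq_edge_flags x : uniq (edge_flags x).
Proof.
rewrite /= !inE !negb_or !(eq_sym x) (t0_free x) (t2_free x) (t02_free x) /=.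
rewrite (inj_eq (inv_inj (@t0K M))) !(eq_sym x) (t2_free x).
rewrite [t2 x == _]eq_sym (t0_free (t2 x)) !andbT eq_sym.
by rewrite -(inj_eq (inv_inj (@t0K M))) t0K (t02_free x).
Qed.

Lemma ed_eqP x y : (ed x == ed y) = (y \in edge_flags x).
Proof.
apply/idP/idP => [|]; last first.
  by rewrite !inE => /or4P[] /eqP->; rewrite ?(ed_t0, ed_t2).
rewrite eq_comp_of => cxy; rewrite -(@closed_connect _ edge_step (mem (edge_flags x)) _ x y) //.
  by rewrite inE eqxx.
apply: intro_closed; first exact/sym_connect_sym/edge_step_sym.
move=> u v; rewrite /edge_step /= !unfold_in orbF => /orP[] /eqP-> /or4P[] /eqP->.
all: by rewrite ?orbF ?(t0K, t2K) -?t02C ?(t0K, t2K) ?eqxx ?orbT.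
Qed.

Lemma sum_flags_by_edges (g : M -> 'F_2) :
  \sum_x g x = \sum_(c : component edge_step)
    (g (val c) + g (t0 (val c)) + g (t2 (val c)) + g (t0 (t2 (val c)))).
Proof.
rewrite (partition_big ed predT) //=; apply: eq_bigr => c _.
rewrite (eq_bigl (mem (edge_flags (val c)))) => [|x]; last first.
  by rewrite -[in LHS](comp_of_val edge_step_sym c) eq_sym ed_eqP.
by rewrite -big_uniq ?uniq_edge_flags //= !big_cons big_nil addr0 !addrA.
Qed.

Lemma flags_connected (U : Type) (g : M -> U) :
  (forall x, g (t0 x) = g x) -> (forall x, g (t1 x) = g x) ->
  (forall x, g (t2 x) = g x) -> forall x y, g x = g y.
Proof.
move=> g0 g1 g2 x y; have /forallP/(_ x)/forallP/(_ y) := flag_connected M.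
by apply: connect_invariant => {}x {}y /= /or3P[] /eqP->.
Qed.

(** Incidence modulo 2: a loop has zero column in [d0], and an edge with one face on both sides has
    zero column in [d2]. The rows of [d2] are the face boundaries. *)
Definition d0 (v : component (@vertex_step M)) (c : component (@edge_step M)) : 'F_2 :=
  (vx (val c) == v)%:R + (vx (t0 (val c)) == v)%:R.

Definition d2 (f : component (@face_step M)) (c : component (@edge_step M)) : 'F_2 :=
  (fc (val c) == f)%:R + (fc (t2 (val c)) == f)%:R.

Lemma sum_d0 u c : \sum_v u v * d0 v c = u (vx (val c)) + u (vx (t0 (val c))).
Proof.
by under eq_bigr do rewrite mulrDr; rewrite big_split /= !sum_mul_delta.
Qed.

Lemma sum_d2 u c : \sum_f u f * d2 f c = u (fc (val c)) + u (fc (t2 (val c))).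
Proof.
by under eq_bigr do rewrite mulrDr; rewrite big_split /= !sum_mul_delta.
Qed.

(** Allows the representative flag of an edge to be replaced by any other of its flags. *)
Lemma ed_rep (g : M -> 'F_2) x : (forall y, g (t0 y) = g y) ->
  (forall y, g (t2 y) = g y) -> g (val (ed x)) = g x.
Proof.
move=> g0 g2; have: connect edge_step x (val (ed x)).
  by rewrite -(eq_comp_of edge_step_sym) comp_of_val.
by move/(connect_invariant (g := g)) => -> // y z; rewrite /edge_step /= => /orP[] /eqP->.
Qed.

Lemma sum_d0_ed u x : \sum_v u v * d0 v (ed x) = u (vx x) + u (vx (t0 x)).
Proof.
rewrite sum_d0; apply: (ed_rep (g := fun x => u (vx x) + u (vx (t0 x)))) => y.
  by rewrite t0K addrC.
by rewrite t02C !vx_t2.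
Qed.

Lemma sum_d2_ed u x : \sum_f u f * d2 f (ed x) = u (fc x) + u (fc (t2 x)).
Proof.
rewrite sum_d2; apply: (ed_rep (g := fun x => u (fc x) + u (fc (t2 x)))) => y.
  by rewrite -t02C !fc_t0.
by rewrite t2K addrC.
Qed.

(* The four corner terms of an edge multiply out to the product of its vertex *)
(* and face differences, and t1 pairs off the corners.                        *)
Lemma d2_d0_orthogonal (u : component (@face_step M) -> 'F_2) w :
  \sum_c (\sum_f u f * d2 f c) * (\sum_v w v * d0 v c) = 0.
Proof.
pose g (x : M) := u (fc x) * w (vx x).
rewrite -[RHS](@sum_free_involution _ t1 g (@t1K M) (@t1_free M)); last first.
  by move=> x; rewrite /g fc_t1 vx_t1.
rewrite sum_flags_by_edges; apply: eq_bigr => c _; rewrite sum_d0 sum_d2 /g.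
rewrite !fc_t0 !t02C !vx_t2 mulrDl !mulrDr !addrA.
by [].
Qed.

(** A vertex function annihilated by [d0] agrees at the two ends of every edge, so it is constant
    because the surface is connected. [rank_d2] is the dual statement. *)
Lemma rank_d0 : (n_comp (@vertex_step M) predT <= (\rank (fun_mx d0)).+1)%N.
Proof.
rewrite -card_component; apply: rank_fun_mx_ker_const => u u0 v v'.
rewrite -(comp_of_val vertex_step_sym v) -(comp_of_val vertex_step_sym v').
apply: (flags_connected (g := fun x => u (vx x))) => x; rewrite ?vx_t1 ?vx_t2 //.
by apply/esym/addr_eq0_F2; rewrite -sum_d0_ed u0.
Qed.

Lemma rank_d2 : (n_comp (@face_step M) predT <= (\rank (fun_mx d2)).+1)%N.
Proof.
rewrite -card_component; apply: rank_fun_mx_ker_const => u u0 v v'.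
rewrite -(comp_of_val face_step_sym v) -(comp_of_val face_step_sym v').
apply: (flags_connected (g := fun x => u (fc x))) => x; rewrite ?fc_t1 ?fc_t0 //.
by apply/esym/addr_eq0_F2; rewrite -sum_d2_ed u0.
Qed.

End SurfaceChains.

(** * Euler genus of embedded bipartite graphs *)

Section BipartiteEmbedding.

Variables (G : sgraph) (c : G -> bool).
Hypothesis cP : forall x y, adj x y -> c x != c y.

(** Orienting each edge away from its end of colour [true] counts it exactly once. *)
Definition bip_edge : finType := {p : G * G | adj p.1 p.2 && c p.1}.

Variables (M : surface) (f : G -> M) (d : bip_edge -> M).
Hypothesis f_inj : forall x y, vx (f x) = vx (f y) -> x = y.
Hypothesis vx_d : forall p, vx (d p) = vx (f (val p).1).
Hypothesis vx_t0d : forall p, vx (t0 (d p)) = vx (f (val p).2).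

Lemma bip_edge_color (p : bip_edge) : c (val p).1 /\ ~~ c (val p).2.
Proof. by case: p => [[x y] /= /andP[/cP + cx]]; rewrite cx; case: (c y). Qed.

(** An edge of [M] determines its pair of ends, and the colouring rules out matching them in
    reverse. *)
Lemma ed_d_inj p q : ed (d p) = ed (d q) -> p = q.
Proof.
have [cp1 cp2] := bip_edge_color p; have [cq1 cq2] := bip_edge_color q.
have same : vx (d q) = vx (d p) -> vx (t0 (d q)) = vx (t0 (d p)) -> p = q.
  rewrite !vx_d !vx_t0d => /f_inj e1 /f_inj e2; apply: val_inj.
  by move: e1 e2; case: (val p) (val q) => [? ?] [? ?] /= -> ->.
have opp : vx (d q) = vx (t0 (d p)) -> p = q.
  by rewrite vx_d vx_t0d => /f_inj e; rewrite e (negPf cp2) in cq1.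
move=> /eqP; rewrite ed_eqP !inE => /or4P[] /eqP e.
- by apply: same; rewrite e.
- by apply: opp; rewrite e.
- by apply: same; rewrite e ?t02C vx_t2.
- by apply: opp; rewrite e ?t02C vx_t2.
Qed.

Definition on_graph (x : M) : bool := [exists p, ed (d p) == ed x].

Lemma on_graph_t2 x : on_graph (t2 x) = on_graph x.
Proof. by rewrite /on_graph ed_t2. Qed.

(* Components of this relation are the regions of the surface cut along G. *)
Definition region_step : rel M :=
  [rel x y | [|| y == t0 x, y == t1 x | (y == t2 x) && ~~ on_graph x]].

Lemma region_step_sym : symmetric region_step.
Proof.
move=> x y; rewrite /region_step /= (eq_sym y (t0 x)) (eq_sym y (t1 x)).
rewrite (inv_eq (@t0K M)) (inv_eq (@t1K M)) !(eq_sym x); congr [|| _, _ | _].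
by rewrite (inv_eq (@t2K M)); case: eqP => // ->; rewrite on_graph_t2.
Qed.

Definition rg := comp_of region_step_sym.

Lemma rg_t0 x : rg (t0 x) = rg x.
Proof. by apply/esym/comp_of_step; rewrite /region_step /= eqxx. Qed.

Lemma rg_t1 x : rg (t1 x) = rg x.
Proof. by apply/esym/comp_of_step; rewrite /region_step /= eqxx orbT. Qed.

Lemma rg_t2 x : ~~ on_graph x -> rg (t2 x) = rg x.
Proof.
by move=> gx; apply/esym/comp_of_step; rewrite /region_step /= eqxx gx !orbT.
Qed.

Let s (p : bip_edge) (e : component (@edge_step M)) : 'F_2 := (ed (d p) == e)%:R.
Let D0 := fun_mx (@d0 M).
Let D2 := fun_mx (@d2 M).
Let S := fun_mx s.
(** The row space of [Z] is the cycle space of [G], carried into the edge chains of [M] by [S]. *)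
Let Z := kermx (S *m D0^T) *m S.

Lemma mul_d2_d0 : D2 *m D0^T = 0.
Proof.
rewrite /D2 /D0 tr_fun_mx mul_fun_mx; apply/matrixP => i j; rewrite !mxE.
have := d2_d0_orthogonal (fun k => (enum_val i == k)%:R) (fun k => (enum_val j == k)%:R).
move=> orth; rewrite -[RHS]orth; apply: eq_bigr => e _.
by congr (_ * _); under eq_bigr do rewrite mulrC; rewrite sum_mul_delta.
Qed.

Lemma row_free_s : row_free S.
Proof.
apply/row_freeP; exists (S^T); rewrite /S tr_fun_mx mul_fun_mx.
apply/matrixP => i j; rewrite !mxE /s; under eq_bigr do rewrite mulrC.
rewrite (sum_mul_delta (fun e => (ed (d (enum_val j)) == e)%:R)).
congr (_ %:R); congr nat_of_bool; apply/eqP/eqP => [/ed_d_inj/enum_val_inj|] -> //.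
Qed.

(** The boundary of an edge of [G] is the sum of two rows of [J], which has one row per vertex of
    [G]. *)
Lemma rank_s_d0 : (\rank (S *m D0^T) <= #|G|)%N.
Proof.
pose J := fun_mx (fun (x : G) v => (vx (f x) == v)%:R : 'F_2).
apply: leq_trans (rank_leq_row J); apply: mxrankS; apply/row_subP => i.
rewrite row_mul /S row_fun_mx /D0 tr_fun_mx mul_fun_rV; set p := enum_val i.
rewrite (_ : fun_rV _ = row (enum_rank (val p).1) J + row (enum_rank (val p).2) J).
  by rewrite addmx_sub ?row_sub.
rewrite !row_fun_mx !enum_rankK; apply/rowP => k; rewrite !mxE /s.
under eq_bigr do rewrite mulrC; rewrite (sum_mul_delta (fun e => d0 (enum_val k) e)).
have := sum_d0_ed (fun v => (enum_val k == v)%:R) (d p).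
under eq_bigr do rewrite mulrC; rewrite sum_mul_delta => ->.
by rewrite vx_d vx_t0d !(eq_sym (enum_val k)).
Qed.

(** If the boundary of a sum of faces is supported on [G], the coefficients agree across every edge
    off [G], hence are constant on each region. *)
Lemma rank_cap_regions : (\rank (D2 :&: Z)%MS <= n_comp region_step predT)%N.
Proof.
(* [K] sends a region to the sum of its faces. *)
pose K := fun_mx (fun (r : component region_step) (h : component face_step) =>
  (r == rg (val h))%:R : 'F_2).
rewrite -card_component; apply: leq_trans (rank_leq_row K).
apply: leq_trans (mxrankM_maxl K D2); apply: mxrankS; apply/rV_subP => v.
rewrite sub_capmx => /andP[/submxP[u vu] /submxP[w]]; rewrite /Z mulmxA.
set w' := w *m _ => vw; pose u1 h := u 0 (enum_rank h).
have u1t2 x : ~~ on_graph x -> u1 (fc (t2 x)) = u1 (fc x).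
  move=> gx; apply/esym/addr_eq0_F2; rewrite -sum_d2_ed.
  transitivity (v 0 (enum_rank (ed x))); last first.
    rewrite vw mxE big1 // => p _; rewrite !mxE enum_rankK /s.
    have /negPf-> : ed (d (enum_val p)) != ed x.
      by apply: contra gx => e; apply/existsP; exists (enum_val p).
    by rewrite mulr0.
  by rewrite vu (fun_rVE u) /D2 mul_fun_rV mxE enum_rankK.
have u1E x y : connect region_step x y -> u1 (fc x) = u1 (fc y).
  apply: (connect_invariant (g := fun x => u1 (fc x))) => {}x {}y.
  rewrite /region_step /= => /or3P[/eqP->|/eqP->|/andP[/eqP-> /u1t2 //]].
    by rewrite fc_t0.
  by rewrite fc_t1.
apply/submxP; exists (fun_rV (fun r => u1 (fc (val r)))).
rewrite mulmxA vu; congr (_ *m _); rewrite [LHS]fun_rVE mul_fun_rV.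
apply: eq_fun_rV => h; under eq_bigr do rewrite eq_sym.
rewrite (sum_mul_delta (fun r => u1 (fc (val r)))) -[in LHS](comp_of_val (@face_step_sym M) h).
by apply: u1E; rewrite -(eq_comp_of region_step_sym) comp_of_val.
Qed.

(** Face boundaries and cycles of [G] all lie in the kernel of [D0^T], so the rank of their sum plus
    that of [D0] is at most the number of edges of [M]. *)
Lemma euler_subgraph :
  (n_comp (@vertex_step M) predT + n_comp (@face_step M) predT + #|bip_edge| <=
   n_comp (@edge_step M) predT + 2 + #|G| + n_comp region_step predT)%N.
Proof.
have zero : (D2 + Z)%MS *m D0^T = 0.
  apply/eqP; rewrite -submx0 (eqmxMr _ (addsmxE _ _)) mul_col_mx mul_d2_d0.
  by rewrite /Z -mulmxA mulmx_ker col_mx0 sub0mx.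
have := mulmx0_rank_max zero; rewrite mxrank_tr; have := card_component (@edge_step M).
have := mxrank_sum_cap D2 Z.
have := mxrankMfree (kermx (S *m D0^T)) row_free_s; rewrite -/Z mxrank_ker.
have := rank_cap_regions; have := rank_s_d0; have := rank_d0 M; have := rank_d2 M.
rewrite -/D0 -/D2 => *; lia.
Qed.

(** * The boundary of a region *)

Section RegionBoundary.

Variable rho : component region_step.
(** The boundary modulo 2: edges of [G] with exactly one side in [rho]. *)
Let b p : bool := (rg (d p) == rho) (+) (rg (t2 (d p)) == rho).

(** Orthogonality is applied to the indicator of the faces in [rho] and to [w] moved to the vertices
    of [M]. Edges off [G] have both sides in one region and contribute nothing. *)
Lemma region_boundary_even (w : G -> 'F_2) :
  \sum_(p | b p) (w (val p).1 + w (val p).2) = 0.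
Proof.
pose u (h : component face_step) : 'F_2 := (rg (val h) == rho)%:R.
have uE x : u (fc x) = (rg x == rho)%:R.
  rewrite /u; congr (nat_of_bool (_ == _))%:R.
  apply: (connect_invariant (g := rg) (e := face_step)).
    by move=> y z; rewrite /face_step /= => /orP[] /eqP->; rewrite ?rg_t0 ?rg_t1.
  by rewrite -(eq_comp_of (@face_step_sym M)) comp_of_val.
(* The value 0 off the image of [f] is harmless: only ends of edges of [G] are evaluated. *)
pose w' (v : component (@vertex_step M)) : 'F_2 :=
  if [pick x | vx (f x) == v] is Some x then w x else 0.
have w'E x : w' (vx (f x)) = w x.
  by rewrite /w'; case: pickP => [y /eqP/f_inj->|/(_ x)] //; rewrite eqxx.
have := d2_d0_orthogonal u w'; rewrite (bigID (fun e => on_graph (val e))) /=.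
rewrite [X in _ + X]big1 ?addr0 => [|e ge]; last first.
  by rewrite sum_d2 !uE rg_t2 // addrr_F2 mul0r.
pose im := [set ed (d p) | p in [set: bip_edge]].
rewrite (eq_bigl (mem im)) => [|e]; last first.
  rewrite !inE -[in RHS](comp_of_val (@edge_step_sym M) e).
  by apply/existsP/imsetP => [[p /eqP edp]|[p _ edp]]; exists p => //; exact/eqP.
rewrite big_imset => [e0|p q _ _ /ed_d_inj //].
rewrite -[RHS]e0 [LHS]big_mkcond [RHS]big_mkcond; apply: eq_bigr => p _; rewrite inE /=.
rewrite sum_d0_ed sum_d2_ed vx_d vx_t0d !w'E !uE /b.
by case: (rg _ == _); case: (rg _ == _); rewrite /= ?addr0 ?add0r ?addrr_F2 ?mul0r ?mul1r.
Qed.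

(** With [w] the indicator of [x], an even number of boundary edges meet [x], so [p0] is not the
    only one. *)
Lemma region_boundary_degree x p0 : b p0 -> x \in [:: (val p0).1; (val p0).2] ->
  exists p, [/\ b p, p != p0 & x \in [:: (val p).1; (val p).2]].
Proof.
move=> bp0 xp0.
have [/existsP[p /and3P[bp pp0 xp]]|/existsPn no] :=
  boolP [exists p, [&& b p, p != p0 & x \in [:: (val p).1; (val p).2]]].
  by exists p.
have wE (p : bip_edge) : (x == (val p).1)%:R + (x == (val p).2)%:R
    = (x \in [:: (val p).1; (val p).2])%:R :> 'F_2.
  have [c1 c2] := bip_edge_color p; rewrite !inE.
  case: eqP => [->|_] /=; last by rewrite add0r.
  by case: eqP => [e|]; rewrite ?addr0 //; rewrite e (negPf c2) in c1.
have := region_boundary_even (fun y => (x == y)%:R).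
rewrite (bigD1 p0) //= wE xp0 big1 => [/eqP|p /andP[bp pp0]].
  by rewrite addr0 oner_eq0.
by rewrite wE; have := no p; rewrite bp pp0 /= => /negPf->.
Qed.

Lemma region_boundary_fst p0 : b p0 ->
  exists p, [/\ b p, (val p).1 = (val p0).1 & (val p).2 != (val p0).2].
Proof.
move=> bp0; have [c1 _] := bip_edge_color p0.
have [|p [bp pp0]] := region_boundary_degree (x := (val p0).1) bp0.
  by rewrite inE eqxx.
have [_ c2] := bip_edge_color p.
rewrite !inE => /orP[] /eqP e; last by rewrite e (negPf c2) in c1.
exists p; split => //; apply: contra pp0 => /eqP e2; apply/eqP/val_inj.
by rewrite [val p]surjective_pairing -e e2 -surjective_pairing.
Qed.

Lemma region_boundary_snd p0 : b p0 ->
  exists p, [/\ b p, (val p).2 = (val p0).2 & (val p).1 != (val p0).1].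
Proof.
move=> bp0; have [_ c2] := bip_edge_color p0.
have [|p [bp pp0]] := region_boundary_degree (x := (val p0).2) bp0.
  by rewrite !inE eqxx orbT.
have [c1 _] := bip_edge_color p.
rewrite !inE => /orP[] /eqP e; first by rewrite e c1 in c2.
exists p; split => //; apply: contra pp0 => /eqP e2; apply/eqP/val_inj.
by rewrite [val p]surjective_pairing -e e2 -surjective_pairing.
Qed.

(** The boundary contains the walk p2, p0, p1, p3, whose edges are distinct because [G] is simple
    and bipartite. *)
Lemma region_boundary_ge4 p0 : b p0 -> (4 <= #|[set p | b p]|)%N.
Proof.
move=> bp0; have [p1 [bp1 e1 n1]] := region_boundary_fst bp0.
have [p2 [bp2 e2 n2]] := region_boundary_snd bp0.
have [p3 [bp3 e3 n3]] := region_boundary_snd bp1.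
have uniq4 : uniq [:: p0; p1; p2; p3].
  have neq (p q : bip_edge) : (val p).1 != (val q).1 \/ (val p).2 != (val q).2 -> p != q.
    by case; apply: contra => /eqP->.
  rewrite /= !inE !negb_or !neq //.
  - by right; rewrite e2 e3 eq_sym.
  - by left; rewrite eq_sym.
  - by left; rewrite e1 eq_sym.
  - by left; rewrite -e1 eq_sym.
  - by left; rewrite eq_sym.
  - by right; rewrite eq_sym.
apply: (@leq_trans #|[:: p0; p1; p2; p3]|); first by rewrite (card_uniqP uniq4).
by apply: subset_leq_card; apply/subsetP => p; rewrite !inE => /or4P[] /eqP->.
Qed.

(** A nonempty boundary has four edges, each with one side in [rho]. An empty boundary for [rho]
    makes [rho] the whole surface, so all sides of at least two edges count. *)
Lemma region_sides_ge4 : (1 < #|bip_edge|)%N ->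
  (4 <= #|[set q : bip_edge * bool | rg (if q.2 then t2 (d q.1) else d q.1) == rho]|)%N.
Proof.
move=> E2; case: (pickP b) => [p0 bp0 | b0].
  apply: leq_trans (region_boundary_ge4 bp0) _.
  rewrite -(card_imset _ (f := fun p => (p, rg (d p) != rho))); last by move=> p q [].
  apply: subset_leq_card; apply/subsetP => _ /imsetP[p + ->]; rewrite !inE /b /=.
  by case: (boolP (rg (d p) == rho)) => h /=.
have bE p : (rg (t2 (d p)) == rho) = (rg (d p) == rho).
  by have := b0 p; rewrite /b; do 2 case: (_ == rho).
have all_rho x : rg x == rho.
  apply: etrans (flags_connected (g := fun x => rg x == rho) _ _ _ x (val rho)) _.
  - by move=> y; rewrite rg_t0.
  - by move=> y; rewrite rg_t1.
  - move=> y; case: (boolP (on_graph y)) => [/existsP[p]|/rg_t2->] //.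
    by rewrite ed_eqP !inE => /or4P[] /eqP->; rewrite ?t02C ?t2K -?t02C 2?rg_t0 ?bE.
  exact/eqP/comp_of_val.
rewrite (_ : [set _ | _] = [set: bip_edge * bool]); last first.
  by apply/setP => q; rewrite !inE all_rho.
by rewrite cardsT card_prod card_bool; lia.
Qed.

End RegionBoundary.

(** The edges of [G] have 2|E| sides in total, and each region receives at least four. *)
Lemma region_count : (1 < #|bip_edge|)%N ->
  (n_comp region_step predT * 2 <= #|bip_edge|)%N.
Proof.
move=> E2; rewrite -(leq_pmul2r (isT : 0 < 2)%N) -mulnA -[(2 * 2)%N]/4%N.
rewrite -card_component -sum_nat_const -{2}card_bool -card_prod -sum1_card.
rewrite (partition_big (fun q : bip_edge * bool =>
  rg (if q.2 then t2 (d q.1) else d q.1)) predT) //=.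
apply: leq_sum => rho _; apply: leq_trans (region_sides_ge4 rho E2) _.
by rewrite -sum1_card; apply: eq_leq; apply: eq_bigl => q; rewrite inE.
Qed.

End BipartiteEmbedding.

Lemma bipartite_euler_genus_lb (G : sgraph) (c : G -> bool) (M : surface) :
  (forall x y, adj x y -> c x != c y) -> (1 < #|bip_edge c|)%N -> embeds G M ->
  #|bip_edge c|%:Z <= surface_euler_genus M *+ 2 + #|G|%:Z *+ 2.
Proof.
move=> cP E2 [f [f_inj f_adj]].
have /fin_all_exists[d dP] (p : bip_edge c) : exists x : M,
    connect vertex_step (f (val p).1) x /\ connect vertex_step (f (val p).2) (t0 x).
  by case: p => [[x y] /= /andP[/f_adj]].
have vxP x y : connect vertex_step x y -> vx y = vx x.
  by move=> xy; apply/esym/comp_ofP.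
have f_inj' x y : vx (f x) = vx (f y) -> x = y by move=> /comp_ofP/f_inj.
have vx_d p : vx (d p) = vx (f (val p).1) by apply: vxP; case: (dP p).
have vx_t0d p : vx (t0 (d p)) = vx (f (val p).2) by apply: vxP; case: (dP p).
have := euler_subgraph cP f_inj' vx_d vx_t0d.
have := region_count cP f_inj' vx_d vx_t0d E2.
by rewrite /surface_euler_genus /euler_char; lia.
Qed.

(** * Surfaces from rotation systems *)

Lemma card_flags (M : surface) : #|M| = (n_comp (@edge_step M) predT * 4)%N.
Proof.
rewrite -card_component -sum_nat_const -sum1_card.
rewrite (partition_big (@ed M) predT) //=; apply: eq_bigr => c _.
rewrite sum1_card -[RHS](card_uniqP (uniq_edge_flags (val c))).
apply: eq_card => x; rewrite -ed_eqP [LHS]unfold_in /= eq_sym.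
by rewrite -[in LHS](comp_of_val (@edge_step_sym M) c).
Qed.

Lemma n_comp_gt0 (T : finType) (e : rel T) (x : T) :
  symmetric e -> (0 < n_comp e predT)%N.
Proof.
by move=> e_sym; rewrite -card_component; apply/card_gt0P; exists (comp_of e_sym x).
Qed.

Definition dart (G : sgraph) : finType := {p : G * G | adj p.1 p.2}.

Section RotationSystem.

Variable G : sgraph.
Implicit Types d : dart G.

(** The enumeration order, read cyclically, is the rotation at [x]; the genus bound holds for any
    rotation. *)
Definition nbrs (x : G) := enum [pred y | adj x y].

Lemma dart_rev_subproof d : adj (val d).2 (val d).1.
Proof. by rewrite adj_sym (valP d). Qed.

Lemma dart_next_subproof d : adj (val d).1 (next (nbrs (val d).1) (val d).2).
Proof.
by have := mem_next (nbrs (val d).1) (val d).2; rewrite !mem_enum !inE (valP d).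
Qed.

Lemma dart_prev_subproof d : adj (val d).1 (prev (nbrs (val d).1) (val d).2).
Proof.
by have := mem_prev (nbrs (val d).1) (val d).2; rewrite !mem_enum !inE (valP d).
Qed.

Definition dart_rev d : dart G :=
  exist _ ((val d).2, (val d).1) (dart_rev_subproof d).
Definition dart_next d : dart G :=
  exist _ ((val d).1, next (nbrs (val d).1) (val d).2) (dart_next_subproof d).
Definition dart_prev d : dart G :=
  exist _ ((val d).1, prev (nbrs (val d).1) (val d).2) (dart_prev_subproof d).

Lemma dart_revK : involutive dart_rev.
Proof. by move=> d; apply: val_inj; rewrite /= -surjective_pairing. Qed.

Lemma dart_nextK : cancel dart_next dart_prev.
Proof.
by move=> d; apply: val_inj; rewrite /= prev_next ?enum_uniq // -surjective_pairing.
Qed.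

Lemma dart_prevK : cancel dart_prev dart_next.
Proof.
by move=> d; apply: val_inj; rewrite /= next_prev ?enum_uniq // -surjective_pairing.
Qed.

Lemma dart_rev_neq d : dart_rev d != d.
Proof.
case: d => [[x y] xy]; apply/eqP => /(congr1 val) /= [yx _].
by move: xy; rewrite /= yx adj_irr.
Qed.

(** A flag sits at the tail of a dart, on the side given by the Boolean. Sides are relative to the
    direction of the dart, so [rot_t0] must flip the Boolean to stay on the same side. *)
Definition rot_flag : finType := (dart G * bool)%type.
Implicit Types u : rot_flag.

Definition rot_t0 u : rot_flag := (dart_rev u.1, ~~ u.2).
Definition rot_t1 u : rot_flag := (if u.2 then dart_next u.1 else dart_prev u.1, ~~ u.2).
Definition rot_t2 u : rot_flag := (u.1, ~~ u.2).

Lemma rot_t0K : involutive rot_t0.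
Proof. by case=> d b; rewrite /rot_t0 /= dart_revK negbK. Qed.
Lemma rot_t1K : involutive rot_t1.
Proof. by case=> d [] /=; rewrite /rot_t1 /= ?dart_nextK ?dart_prevK. Qed.
Lemma rot_t2K : involutive rot_t2.
Proof. by case=> d b; rewrite /rot_t2 /= negbK. Qed.
Lemma rot_t0_free u : rot_t0 u != u.
Proof. by case: u => d []; rewrite xpair_eqE andbF. Qed.
Lemma rot_t1_free u : rot_t1 u != u.
Proof. by case: u => d []; rewrite xpair_eqE andbF. Qed.
Lemma rot_t2_free u : rot_t2 u != u.
Proof. by case: u => d []; rewrite xpair_eqE andbF. Qed.
Lemma rot_t02C u : rot_t0 (rot_t2 u) = rot_t2 (rot_t0 u).
Proof. by []. Qed.
Lemma rot_t02_free u : rot_t0 (rot_t2 u) != u.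
Proof. by case: u => d b; rewrite xpair_eqE (negPf (dart_rev_neq d)). Qed.

Definition rot_vertex_step : rel rot_flag :=
  [rel u v | (v == rot_t1 u) || (v == rot_t2 u)].

(** Alternating [rot_t1] and [rot_t2] turns through the cyclic rotation and so reaches every dart
    with the same tail. *)
Lemma rot_vertex_connect u v :
  (val u.1).1 = (val v.1).1 -> connect rot_vertex_step u v.
Proof.
have flip d b b' : connect rot_vertex_step (d, b) (d, b').
  have [->//|bb'] := eqVneq b b'; apply: connect1.
  rewrite /rot_vertex_step /= [X in _ || X]xpair_eqE eqxx.
  by case: b b' bb' => [] []; rewrite ?orbT.
have iterP d n : connect rot_vertex_step (d, true) (iter n dart_next d, true).
  elim: n => //= n IH; apply: connect_trans IH _.
  apply: connect_trans (flip _ false _); apply: connect1.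
  by rewrite /rot_vertex_step /= [X in X || _]eqxx.
case: u v => [d b] [d' b'] /= dd'.
apply: connect_trans (flip _ _ true) _; apply: connect_trans (flip _ true _).
have Un : uniq (nbrs (val d).1) by rewrite enum_uniq.
have : fconnect (next (nbrs (val d).1)) (val d).2 (val d').2.
  rewrite (fconnect_cycle (cycle_next Un)) ?mem_enum ?inE ?(valP d) //.
  by rewrite dd' (valP d').
move/iter_findex; move: (findex _ _ _) => n nE.
suff -> : d' = iter n dart_next d by apply: iterP.
apply: val_inj; rewrite [LHS]surjective_pairing -dd' -nE.
elim: n {nE} => [|n IH] /=; first by rewrite -surjective_pairing.
by rewrite -IH.
Qed.

Hypothesis G_conn : forall x y : G, connect (@adj G) x y.
Hypothesis G_deg : forall x : G, exists y, adj x y.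
Variable x0 : G.

Definition vertex_flag (x : G) : rot_flag :=
  (exist _ (x, xchoose (G_deg x)) (xchooseP (G_deg x)), true).

Lemma rot_flag_gt0 : (0 < #|rot_flag|)%N.
Proof. by apply/card_gt0P; exists (vertex_flag x0). Qed.

Lemma rot_connected : connected_rel
  [rel u v : rot_flag | [|| v == rot_t0 u, v == rot_t1 u | v == rot_t2 u]].
Proof.
set e := (X in connected_rel X); apply/forallP => u; apply/forallP => v.
have same w w' : (val w.1).1 = (val w'.1).1 -> connect e w w'.
  move=> /rot_vertex_connect; apply: connect_sub => {}w {}w'.
  rewrite /rot_vertex_step /= => ww'; apply: connect1; rewrite /e /=.
  by rewrite ww' orbT.
have /connectP[p] := G_conn (val u.1).1 (val v.1).1.
elim: p u => [|y p IH] u /= => [_ e0|/andP[uy py] lasty].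
  exact/same/esym.
pose w : rot_flag := (exist _ ((val u.1).1, y) uy, true).
apply: connect_trans (same u w erefl) _; apply: (@connect_trans _ _ (rot_t0 w)).
  by apply: connect1; rewrite /e /= eqxx.
exact: IH.
Qed.

Definition rot_surface : surface := Surface rot_t0K rot_t1K rot_t2K
  rot_t0_free rot_t1_free rot_t2_free rot_t02C rot_t02_free rot_flag_gt0 rot_connected.

Lemma rot_surface_embeds : embeds G rot_surface.
Proof.
exists vertex_flag; split => [x y | x y xy].
  move=> /(connect_invariant (g := fun u : rot_surface => (val u.1).1)).
  apply => u v; rewrite /vertex_step /= => /orP[] /eqP-> //=.
  by rewrite /rot_t1 /=; case: (u.2).
exists ((exist _ (x, y) xy, true) : rot_surface).
by split; apply: rot_vertex_connect.
Qed.

(** There is at least one vertex and one face, so the genus is at most the number of edges, which is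
    half the number of darts. *)
Lemma rot_surface_genus : surface_euler_genus rot_surface *+ 2 <= #|dart G|%:Z.
Proof.
have := card_flags rot_surface; rewrite card_prod card_bool.
have := n_comp_gt0 (vertex_flag x0 : rot_surface) (@vertex_step_sym rot_surface).
have := n_comp_gt0 (vertex_flag x0 : rot_surface) (@face_step_sym rot_surface).
by rewrite /surface_euler_genus /euler_char; lia.
Qed.

End RotationSystem.

Lemma ex_has_euler_genus (G : sgraph) (M : surface) : embeds G M ->
  (forall M' : surface, embeds G M' -> 0 <= surface_euler_genus M') ->
  exists g, has_euler_genus G g.
Proof.
move=> GM ge0.
pose P n := `[< exists M', embeds G M' /\ surface_euler_genus M' = Posz n >].
have natM M' : embeds G M' -> surface_euler_genus M' = Posz `|surface_euler_genus M'|%N.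
  by move=> /ge0; lia.
have exP : exists n, P n.
  by exists `|surface_euler_genus M|%N; apply/asboolP; exists M; split => //; apply: natM.
case: (ex_minnP exP) => g /asboolP Pg min_g; exists g; split => // M' GM'.
rewrite natM // lez_nat; apply: min_g; apply/asboolP; exists M'.
by split => //; apply: natM.
Qed.

Lemma bin_ge n m : (0 < m < n)%N -> (n <= 'C(n, m))%N.
Proof.
elim: n m => [|n IH] [|m] //; rewrite ltnS => /= mn; rewrite binS.
have [<-|] := eqVneq m.+1 n; first by rewrite binn binSn.
move=> ne; have := IH m.+1; have := bin_gt0 n m; lia.
Qed.

Lemma card_pairs (T : finType) (P : pred (T * T)) :
  #|{: {p | P p}}| = (\sum_x \sum_y P (x, y))%N.
Proof.
rewrite card_sig -sum1_card big_mkcond (pair_bigA _ (fun x y => nat_of_bool (P (x, y)))) /=.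
by apply: eq_bigr => -[x y] _; rewrite inE; case: (P _).
Qed.

(** * The incidence graph of points and r-subsets *)

Section IncidenceGraph.

Variables k r : nat.

Definition rset : finType := {A : {set 'I_k} | #|A| == r}.

Definition inc_adj (u v : 'I_k + rset) : bool :=
  match u, v with
  | inl i, inr A | inr A, inl i => i \in val A
  | _, _ => false
  end.

Lemma inc_adj_sym : symmetric inc_adj.
Proof. by move=> [i|A] [j|B]. Qed.

Lemma inc_adj_irr : irreflexive inc_adj.
Proof. by case. Qed.

Definition inc_graph : sgraph := SGraph inc_adj_sym inc_adj_irr.

Definition is_point (u : inc_graph) : bool := if u is inl _ then true else false.

Lemma inc_graph_bipartite (u v : inc_graph) : adj u v -> is_point u != is_point v.
Proof. by case: u v => [i|A] [j|B]. Qed.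

Lemma card_rset : #|rset| = 'C(k, r).
Proof.
by rewrite card_sig -[X in 'C(X, _)](card_ord k) -card_draws cardsE.
Qed.

Lemma card_inc_graph : #|inc_graph| = (k + 'C(k, r))%N.
Proof. by rewrite card_sum card_ord card_rset. Qed.

Lemma sum_incidences : (\sum_(A : rset) \sum_(i < k) (i \in val A) = r * 'C(k, r))%N.
Proof.
rewrite mulnC -card_rset -sum_nat_const; apply: eq_bigr => A _.
transitivity #|val A|; last exact/eqP/(valP A).
by rewrite -sum1_card [RHS]big_mkcond; apply: eq_bigr => i _; case: (_ \in _).
Qed.

Lemma card_inc_bip_edge : #|bip_edge is_point| = (r * 'C(k, r))%N.
Proof.
rewrite card_pairs /= big_sumType /=.
rewrite [X in (_ + X)%N]big1 ?addn0 => [|A _]; last first.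
  by rewrite big1 // => y _; rewrite andbF.
rewrite -sum_incidences [RHS]exchange_big; apply: eq_bigr => i _ /=.
by rewrite big_sumType /= big1 // add0n; apply: eq_bigr => A _; rewrite andbT.
Qed.

Lemma card_inc_dart : #|dart inc_graph| = (r * 'C(k, r) * 2)%N.
Proof.
rewrite card_pairs /= big_sumType /= muln2 -addnn -sum_incidences; congr (_ + _)%N.
  rewrite [RHS]exchange_big; apply: eq_bigr => i _ /=.
  by rewrite big_sumType /= big1.
by apply: eq_bigr => A _; rewrite big_sumType /= [X in (_ + X)%N]big1 ?addn0.
Qed.

Lemma rset_avoid (S : {set inc_graph}) (A : rset) : (#|S| < r)%N ->
  exists2 i, i \in val A & (inl i : inc_graph) \notin S.
Proof.
move=> Sr; apply/exists_inP; apply: contraLR Sr; rewrite negb_exists_in -leqNgt.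
move=> /forall_inP AS; apply: (@leq_trans #|val A|); first exact/eq_leq/esym/eqP/(valP A).
rewrite -(card_imset _ (@inl_inj 'I_k rset)).
apply: subset_leq_card; apply/subsetP => _ /imsetP[i iA ->].
exact/negPn/AS.
Qed.

Hypothesis r_ge3 : (3 <= r)%N.
Hypothesis k_ge : (r + 2 <= k)%N.

(** At least k - 2 >= r of the r-subsets contain both points, more than [S] can hold. *)
Lemma rset_pair (S : {set inc_graph}) (i j : 'I_k) : (#|S| < r)%N -> i != j ->
  exists A : rset, [/\ i \in val A, j \in val A & (inr A : inc_graph) \notin S].
Proof.
move=> Sr ij.
have [/existsP[A /and3P[iA jA AS]]|/existsPn no] :=
  boolP [exists A : rset, [&& i \in val A, j \in val A & (inr A : inc_graph) \notin S]].
  by exists A.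
(* [D] lists the r-subsets through i and j with these two points removed; if none avoids [S], then
   [g] maps [S] onto a family containing all of them. *)
pose D := [set B : {set 'I_k} | B \subset ~: [set i; j] & #|B| == (r - 2)%N].
pose g (u : inc_graph) := if u is inr A then val A else set0.
have DB B : B \in D -> [set i; j] :&: B = set0 /\ #|B| = (r - 2)%N.
  by rewrite inE => /andP[]; rewrite subsetC -disjoints_subset -setI_eq0 => /eqP-> /eqP.
have inj : {in D &, injective (fun B => [set i; j] :|: B)}.
  have KB B : B \in D -> ([set i; j] :|: B) :\: [set i; j] = B.
    move=> /DB[eB _]; rewrite setDUl setDv set0U; apply/setDidPl.
    by rewrite disjoint_sym -setI_eq0 eB.
  by move=> B B' BD B'D eBB'; rewrite -(KB B) //= eBB' KB.
exfalso.
have : (#|D| <= #|S|)%N.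
  rewrite -(card_in_imset inj); apply: leq_trans (leq_imset_card g S).
  apply: subset_leq_card; apply/subsetP => _ /imsetP[B /DB[eB cB] ->].
  have cU : #|[set i; j] :|: B| == r.
    by rewrite cardsU eB cards0 cards2 ij cB; lia.
  pose A : rset := exist (fun A : {set 'I_k} => #|A| == r) _ cU.
  apply/imsetP; exists (inr A : inc_graph) => //.
  by have := no A; rewrite /= !inE !eqxx orbT /= negbK.
have := cardsC [set i; j]; rewrite cards2 ij card_ord => cC.
rewrite cards_draws => leS; have : (#|~: [set i; j]| <= #|S|)%N.
  apply: leq_trans leS; apply: bin_ge; lia.
move: cC Sr; rewrite /=; lia.
Qed.

(** Outside [S], every r-subset keeps a point, and any two points keep a common r-subset. *)
Lemma inc_graph_r_connected : r_connected r inc_graph.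
Proof.
split; first by rewrite card_inc_graph; lia.
move=> S Sr; set e := (X in connect X).
have e_sym : connect_sym e.
  by apply: sym_connect_sym => u v; rewrite /e /= (inc_adj_sym u v) andbCA.
have step u v : u \notin S -> v \notin S -> adj u v -> connect e u v.
  by move=> uS vS uv; apply: connect1; rewrite /e /= uS vS.
have to_pt u : u \notin S -> exists2 i, (inl i : inc_graph) \notin S & connect e u (inl i).
  case: u => [i iS|A AS]; first by exists i.
  by have [i iA iS] := rset_avoid A Sr; exists i => //; apply: step.
have pts i j : (inl i : inc_graph) \notin S -> (inl j : inc_graph) \notin S ->
    connect e (inl i) (inl j).
  move=> iS jS; have [->//|ij] := eqVneq i j.
  have [A [iA jA AS]] := rset_pair Sr ij.
  by apply: (@connect_trans _ _ (inr A)); apply: step.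
move=> u v; rewrite !inE => uS vS.
have [i iS ui] := to_pt u uS; have [j jS vj] := to_pt v vS.
apply: connect_trans ui _; apply: connect_trans (pts i j iS jS) _.
by rewrite e_sym.
Qed.

Lemma inc_graph_connected (u v : inc_graph) : connect (@adj inc_graph) u v.
Proof.
have := inc_graph_r_connected => -[_ /(_ set0)]; rewrite cards0 => /(_ _ u v) conn.
apply: connect_sub (conn _ _ _) => [x y /= /and3P[_ _ /connect1] //| | |].
all: by rewrite ?inE //; lia.
Qed.

Lemma inc_graph_deg (u : inc_graph) : exists v, adj u v.
Proof.
case: u => [i|A].
  have /card_gt0P[j ji] : (0 < #|[set~ i]|)%N.
    by have := cardsC1 i; rewrite card_ord; lia.
  have ij : i != j by move: ji; rewrite !inE eq_sym.
  have S0 : (#|set0 : {set inc_graph}| < r)%N by rewrite cards0; lia.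
  by have [A [iA _ _]] := rset_pair S0 ij; exists (inr A).
have [|i iA _] := @rset_avoid set0 A; first by rewrite cards0; lia.
by exists (inl i).
Qed.

(** * Leaves among the points *)

Definition points : {set inc_graph} := [set u | is_point u].

Lemma card_points : #|points| = k.
Proof.
rewrite -[RHS](card_ord k) -(card_imset _ (@inl_inj 'I_k rset)); apply: eq_card => u.
rewrite inE; case: u => [i|A] /=; first by rewrite imset_f.
by apply/esym/imsetP => -[].
Qed.

Lemma card_point_leaves (T : {set {set inc_graph}}) :
  spanning_tree T -> (#|points :&: leaves T| < r)%N.
Proof.
move=> /and3P[/subsetP Tsub /forallP Tconn _]; rewrite ltnNge; apply/negP => rL.
have /set0Pn[B] : [set B : {set inc_graph} | B \subset points :&: leaves T & #|B| == r] != set0.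
  by rewrite -card_gt0 cards_draws bin_gt0.
rewrite inE => /andP[/subsetP BL /eqP cB].
pose A := [set i : 'I_k | (inl i : inc_graph) \in B].
have imA : [set (inl i : inc_graph) | i in A] = B.
  apply/setP => u; apply/imsetP/idP => [[i + ->]|uB]; first by rewrite inE.
  move: (uB) => /BL; rewrite !inE; case: u uB => [i|?] //= uB _.
  by exists i; rewrite ?inE.
have cA : #|A| == r by rewrite -cB -imA (card_imset _ (@inl_inj 'I_k rset)).
pose a : inc_graph := inr (exist (fun A : {set 'I_k} => #|A| == r) A cA).
have subT u v : sub_adj T u v -> adj u v.
  rewrite /sub_adj /= => /Tsub; rewrite inE => /existsP[x /existsP[y /andP[xy /eqP e]]].
  have : (x \in [set u; v]) && (y \in [set u; v]) by rewrite e !inE !eqxx orbT.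
  rewrite !inE => /andP[/orP[] /eqP ex /orP[] /eqP ey]; move: xy; rewrite ex ey ?adj_irr //.
  by rewrite adj_sym.
pose C := [pred u | (u == a) || (sub_adj T a u)].
have Tsym u v : sub_adj T u v = sub_adj T v u by rewrite /sub_adj /= setUC.
have Ccl u v : sub_adj T u v -> u \in C -> v \in C.
  move=> uv; rewrite !inE => /orP[/eqP ua|au]; first by rewrite -ua uv orbT.
  have : u \in B.
    by have := subT _ _ au; case: (u) => [i|?] //=; rewrite inE.
  move=> /BL; rewrite !inE => /andP[_ /cards1P[w /setP wE]].
  have := wE v; have := wE a; rewrite !inE uv Tsym au => /esym/eqP-> /esym/eqP->.
  by rewrite eqxx.
have /card_gt0P[j jA] : (0 < #|~: A|)%N by have := cardsC A; rewrite card_ord (eqP cA); lia.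
have : (inl j : inc_graph) \in C.
  have /forallP/(_ (inl j)) := Tconn a => /closed_connect <-; last first.
  - apply: intro_closed => //; exact/sym_connect_sym.
  by rewrite inE eqxx.
rewrite !inE /= => /subT /=; rewrite inE => jB.
by move: jA; rewrite !inE jB.
Qed.

Lemma robust_connectivity_inc_graph (R : realType) :
  robust_connectivity R inc_graph <= (r.-1)%:R / k%:R.
Proof.
rewrite /robust_connectivity; apply: (bigmin_inf points).
  by rewrite -card_gt0 card_points; lia.
apply: bigmax_le => [|T /card_point_leaves lt_r]; first by rewrite divr_ge0.
by rewrite card_points ler_wpM2r ?invr_ge0 // ler_nat; lia.
Qed.

End IncidenceGraph.

(** * Numerical estimates *)

Local Close Scope ring_scope.

Lemma bernoulli_pred p q : 0 < p -> (p - q) * p ^ q <= p * p.-1 ^ q.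
Proof.
move=> p_gt0; elim: q => [|q IH]; first by rewrite !expn0 subn0.
rewrite !expnS [leqRHS]mulnCA; apply: leq_trans (leq_mul (leqnn p.-1) IH).
rewrite !mulnA leq_mul2r; apply/orP; right; nia.
Qed.

Lemma expn_succ_le m : 0 < m -> m.+1 ^ m.+1 <= 4 * m ^ m.+1.
Proof.
move=> m_gt0; have := @bernoulli_pred m.+1 m.+1./2 isT; set q := m.+1./2.
have pE : m.+1 = odd m.+1 + q * 2 by rewrite muln2 odd_double_half.
have expE x : x ^ m.+1 = x ^ odd m.+1 * (x ^ q * x ^ q).
  by rewrite [in LHS]pE expnD expnM mulnn.
rewrite !expE /= -/(odd m.+1); move: (m ^ q) (m.+1 ^ q) => a b.
case: (odd m.+1) pE => /= pE; rewrite ?expn1 ?expn0 ?mul1n => ab; last first.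
  have {}ab : b <= 2 * a by rewrite -(@leq_pmul2l q); nia.
  by have := leq_mul ab ab; nia.
have mE : m = q * 2 by lia.
clearbody q; subst m.
have {}ab : q.+1 * b <= (q * 2).+1 * a.
  by apply: leq_trans ab; rewrite leq_mul2r; apply/orP; right; lia.
rewrite -(@leq_pmul2l (q.+1 * q.+1)) //.
have := leq_mul (leqnn (q * 2).+1) (leq_mul ab ab) => abab.
apply: (@leq_trans ((q * 2).+1 * ((q * 2).+1 * a * ((q * 2).+1 * a)))).
  by apply: leq_trans abab; apply: eq_leq; ring.
have : (q * 2).+1 * (q * 2).+1 * (q * 2).+1 <= q.+1 * q.+1 * (q * 8) by nia.
move=> /(leq_mul (leqnn (a * a))); nia.
Qed.

Lemma expn_lt_fact m : m ^ m.+1 < 4 ^ m.+1 * m`!.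
Proof.
elim: m => [//|[_ //|m IH]]; have := @expn_succ_le m.+1 isT => le4.
rewrite expnS factS [4 ^ _]expnS.
apply: leq_ltn_trans (leq_mul (leqnn m.+2) le4) _.
by rewrite mulnCA -mulnA ltn_pmul2l // mulnCA ltn_pmul2l.
Qed.

Lemma ffact_le_expn n m : n ^_ m <= n ^ m.
Proof. by elim: m => // m IH; rewrite ffactnSr expnSr leq_mul ?leq_subr. Qed.

Lemma bin_lower_linear r k j : 3 <= r -> k = r + 2 + j -> 3 * j <= 'C(k, r).
Proof.
move=> r3; elim: j k => [|j IH] k -> //; rewrite addnS; case: r r3 IH => // r r3 IH.
have ge : r.+1 + 2 + j <= 'C(r.+1 + 2 + j, r) by apply: bin_ge; lia.
by rewrite binS; have := IH _ erefl; lia.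
Qed.

Lemma infinite_set_nat (A : set nat) :
  (forall n, exists2 m, n < m & A m) -> infinite_set A.
Proof.
move=> unbounded /finite_seqP[s As].
have [m lt_m] := unbounded (\max_(x <- s) x); rewrite As /= => ms.
by have := @leq_bigmax_seq _ s predT id m ms isT; rewrite leqNgt lt_m.
Qed.

Local Open Scope ring_scope.

Lemma lt_powR_root (R : realType) (r k g : nat) : (0 < r)%N -> (0 < k)%N -> (0 < g)%N ->
  (r.-1 ^ r * g < (4 * k) ^ r)%N ->
  (r.-1)%:R / k%:R < 4 * (g%:R `^ (- r%:R^-1)) :> R.
Proof.
move=> r_gt0 k_gt0 g_gt0 lt_g; set a : R := g%:R `^ r%:R^-1.
have a_gt0 : 0 < a by rewrite powR_gt0 ?ltr0n.
have aX : a ^+ r = g%:R.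
  by rewrite -powR_mulrn ?ltW // -powRrM mulVf ?powRr1 // pnatr_eq0 -lt0n.
rewrite powRN -/a ltr_pdivrMr ?ltr0n // mulrAC ltr_pdivlMr //.
rewrite -(ltr_pXn2r r_gt0) ?nnegrE ?mulr_ge0 ?ler0n ?(ltW a_gt0) //.
by rewrite exprMn aX -natrX -!natrM -natrX ltr_nat.
Qed.

Theorem theorem8 (R : realType) (r : nat) (hr : (3 <= r)%N) :
  infinite_set [set gamma : nat | exists G : sgraph,
    [/\ r_connected r G,
        has_euler_genus G gamma
      & (robust_connectivity R G < 4 * (gamma%:R `^ (- r%:R^-1)))%R]]%classic.
Proof.
apply: infinite_set_nat => n.
pose k := (r + 2 + (2 * (r + 2) + n * 2 + 2))%N.
have k_ge : (r + 2 <= k)%N by rewrite leq_addr.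
have r_gt0 : (0 < r)%N by lia.
have k_gt0 : (0 < k)%N by lia.
have binE : (3 * (2 * (r + 2) + n * 2 + 2) <= 'C(k, r))%N by apply: bin_lower_linear.
pose G := inc_graph k r.
have lb M : embeds G M -> n%:Z < surface_euler_genus M.
  have E2 : (1 < #|bip_edge (@is_point k r)|)%N by rewrite card_inc_bip_edge; nia.
  move=> /(bipartite_euler_genus_lb (@inc_graph_bipartite k r) E2).
  rewrite card_inc_bip_edge card_inc_graph => le_g.
  have : (3 * 'C(k, r) <= r * 'C(k, r))%N by rewrite leq_mul2r hr orbT.
  by move: binE le_g; rewrite /k; lia.
pose M := rot_surface (inc_graph_connected hr k_ge) (inc_graph_deg hr k_ge)
  (inl (Ordinal k_gt0) : G).
have GM : embeds G M by apply: rot_surface_embeds.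
have [|g gG] := ex_has_euler_genus GM; first by move=> M' /lb; lia.
have [[M' [GM' gM']] g_min] := gG.
have n_lt_g : (n < g)%N by have := lb _ GM'; rewrite gM' ltz_nat.
exists g => //; exists G; split => //; first exact: inc_graph_r_connected.
apply: le_lt_trans (robust_connectivity_inc_graph hr k_ge R) _.
apply: lt_powR_root => //; first by lia.
have g_le : (g <= r * 'C(k, r))%N.
  have := g_min _ GM; have := rot_surface_genus (inc_graph_connected hr k_ge)
    (inc_graph_deg hr k_ge) (inl (Ordinal k_gt0) : G).
  by rewrite -/M card_inc_dart; lia.
have g_fact : (g * r.-1`! <= k ^ r)%N.
  apply: leq_trans (ffact_le_expn k r); rewrite -bin_ffact.
  have -> : r`! = (r * r.-1`!)%N by case: (r) r_gt0 => // m _; rewrite factS.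
  by rewrite mulnA leq_mul2r [('C(_, _) * r)%N]mulnC g_le orbT.
have := expn_lt_fact r.-1; rewrite prednK // => lt4.
rewrite expnMn; apply: (@leq_trans (4 ^ r * r.-1`! * g)).
  by rewrite ltn_pmul2r //; lia.
by rewrite -mulnA leq_mul2l (mulnC _ g) g_fact orbT.
Qed.
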